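(* Let $(\boldsymbol{\nu},\mathbf{G},T)$ be an instance of Rotting Graph-Triggered Bandits with $k$ arms such that $\mathbf{G}\in\mathbb{B}_{\widetilde k}$ is block-diagonal, with clique partition $\mathcal{C}_{\mathbf{G}}$ of $[k]$. Then the greedy policy $\pi^*_{\boldsymbol{\nu},\mathbf{G},T}$ given by $$\pi^*_{\boldsymbol{\nu},\mathbf{G},T}(t)\in\operatorname*{arg\,max}_{j\in[k]}\ \mu_j\big(\widetilde N^*_{j,t-1}+1\big),\qquad\forall t\in[T],$$ where $\widetilde N^*_{j,t-1}$ is the number of times arm $j$ has been triggered by this policy in rounds $1,\dots,t-1$, is optimal: $\pi^*_{\boldsymbol{\nu},\mathbf{G},T}\in\operatorname*{arg\,max}_{\pi}J_{\boldsymbol{\nu},\mathbf{G},T}(\pi)$. Moreover, its value $J^*_{\boldsymbol{\nu},\mathbf{G},T}=J_{\boldsymbol{\nu},\mathbf{G},T}(\pi^*_{\boldsymbol{\nu},\mathbf{G},T})$ satisfies $$J^*_{\boldsymbol{\nu},\mathbf{G},T}=\sum_{C_m\in\mathcal{C}_{\mathbf{G}}}\ \sum_{n=1}^{N^*_{C_m,T}}\ \max_{i\in C_m}\mu_i(n),$$ where $N^*_{C_m,T}$ is the number of rounds in $[T]$ in which $\pi^*_{\boldsymbol{\nu},\mathbf{G},T}$ pulls an arm of $C_m$ (so $N^*_{C_m,T}=\widetilde N^*_{i,T}$ for every $i\in C_m$).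
   Context: Graph-Triggered Bandits (GTB): there are $k$ arms, a horizon $T\in\mathbb{N}$, and a symmetric connectivity matrix $\mathbf{G}\in\{0,1\}^{k\times k}$ with $\mathbf{G}_{i,i}=1$ for all $i\in[k]=\{1,\dots,k\}$. At each round $t\in[T]$ the policy $\pi$ selects an arm $I_t$ as a function of the past history of arms and rewards. The number of triggers of arm $i$ up to and including round $t$ is $\widetilde N_{i,t}=\sum_{\tau=1}^{t}\mathbf{1}\{\mathbf{G}_{I_\tau,i}=1\}$, $\widetilde N_{i,0}=0$. Pulling $I_t$ yields a reward drawn from a distribution $\nu_{I_t,n}$ with $n=\widetilde N_{I_t,t}$, whose mean is $\mu_{I_t}(n)\in[0,1]$. The performance of $\pi$ is $J_{\boldsymbol{\nu},\mathbf{G},T}(\pi)=\mathbb{E}\big[\sum_{t=1}^T\mu_{I_t}(\widetilde N_{I_t,t})\big]$. Rotting GTB: for every arm $i$ and every $n$, $\mu_i(n+1)-\mu_i(n)\le0$. $\mathbf{G}\in\mathbb{B}_{\widetilde k}$ means: there is a partition $\mathcal{C}_{\mathbf{G}}$ of $[k]$ into $\widetilde k$ classes (cliques) such that $\mathbf{G}_{i,j}=1$ iff $i,j$ are in the same class. *)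

(* Defs.v *)
From HB Require Import structures.
From mathcomp Require Import all_boot all_order all_algebra.
From mathcomp Require Import all_classical all_reals all_analysis.
From mathcomp Require Import measurable_realfun giry.

Set Implicit Arguments.
Unset Strict Implicit.
Unset Printing Implicit Defensive.

Import Order.TTheory GRing.Theory Num.Theory.

Local Open Scope classical_set_scope.
Local Open Scope ring_scope.

Section triggers.
Variable k : nat.
Implicit Types (G : 'M[bool]_k) (s : seq 'I_k) (C : {set {set 'I_k}}).

Definition connectivity_matrix G :=
  (forall i j, G i j = G j i) /\ (forall i, G i i).

Definition clique_partition G C :=
  finset.partition C [set: 'I_k]%SET /\
  forall i j, G i j = [exists c in C, (i \in c) && (j \in c)].

Definition block_diagonal (ktilde : nat) G :=
  exists2 C, clique_partition G C & #|C| = ktilde.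

Definition triggers G s i := count (fun j => G j i) s.

End triggers.

Section interaction.
Context (R : realType) (k : nat).

(* Arms and rewards of the past rounds, in chronological order. *)
Definition history := seq ('I_k * R).

Definition arms (h : history) : seq 'I_k := [seq z.1 | z <- h].

(* [act h] is the arm pulled in round [(size h).+1] (rounds are numbered from
   1).  [measurable_act] says that [act] is measurable on the histories of each
   length, the finite set of arms carrying the discrete sigma-algebra. *)
Record policy := Policy {
  act :> history -> 'I_k ;
  measurable_act : forall t (a : t.-tuple 'I_k) (i : 'I_k),
    measurable [set x : t.-tuple (measurableTypeR R) | act (zip a x) = i] }.

(* The policy being deterministic given the past, the history is a function of
   the rewards [x] observed so far. *)
Definition trajectory (pi : policy) (x : seq R) : history :=
  foldl (fun h r => rcons h (pi h, r)) [::] x.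

Definition pull (pi : policy) (x : seq R) : 'I_k := pi (trajectory pi x).

Variables (nu : 'I_k -> nat -> probability (measurableTypeR R) R)
          (G : 'M[bool]_k).

Definition mu i n : R := Rintegral (nu i n) [set: measurableTypeR R] id.

(* A pulled arm has been triggered at least once, current round included, so
   [nu i 0] is never sampled and is left unconstrained. *)
Definition gtb :=
  connectivity_matrix G /\
  forall i n, (1 <= n)%N ->
    (nu i n).-integrable [set: measurableTypeR R] EFin /\ 0 <= mu i n <= 1.

Definition rotting_gtb :=
  gtb /\ forall i n, (1 <= n)%N -> mu i n.+1 - mu i n <= 0.

Section law.
Variable pi : policy.

(* Number of triggers of [i] in rounds 1, ..., size x. *)
Definition ntriggers (x : seq R) (i : 'I_k) : nat :=
  triggers G (arms (trajectory pi x)) i.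

(* Number of triggers, current round included, of the arm pulled in round
   [(size x).+1]. *)
Definition ntriggers_pull (x : seq R) : nat :=
  triggers G (rcons (arms (trajectory pi x)) (pull pi x)) (pull pi x).

(* Number of rounds among 1, ..., size x in which an arm of [c] is pulled. *)
Definition npulls (x : seq R) (c : {set 'I_k}) : nat :=
  count (mem c) (arms (trajectory pi x)).

Definition reward_law (x : seq R) : probability (measurableTypeR R) R :=
  nu (pull pi x) (ntriggers_pull x).

Lemma trajectory_rcons x r :
  trajectory pi (rcons x r) = rcons (trajectory pi x) (pull pi x, r).
Proof. by rewrite /trajectory foldl_rcons. Qed.

Lemma size_trajectory x : size (trajectory pi x) = size x.
Proof.
by elim/last_ind: x => // x r ih; rewrite trajectory_rcons !size_rcons ih.
Qed.

Lemma trajectoryE x : trajectory pi x = zip (arms (trajectory pi x)) x.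
Proof.
elim/last_ind: x => // x r ih.
rewrite trajectory_rcons /arms map_rcons zip_rcons ?size_map ?size_trajectory//.
by rewrite -/(arms _) -ih.
Qed.

Lemma measurable_rcons t :
  measurable_fun [set: t.-tuple (measurableTypeR R) * measurableTypeR R]
    (fun z => [tuple of rcons z.1 z.2]).
Proof.
apply/measurable_fun_tnthP => i.
have [it|ti] := ltnP i t.
  rewrite (_ : _ \o _ = fun z => tnth z.1 (Ordinal it)).
    apply: (@measurableT_comp _ _ _ _ _ _
      (fun h : t.-tuple (measurableTypeR R) => tnth h (Ordinal it))) => //.
    exact: measurable_tnth.
  by apply/funext => z /=; rewrite !(tnth_nth 0) /= nth_rcons size_tuple it.
rewrite (_ : _ \o _ = snd); first exact: measurable_snd.
apply/funext => z /=.
have it : i = t :> nat by apply/eqP; rewrite eqn_leq ti -ltnS ltn_ord.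
by rewrite (tnth_nth 0) /= nth_rcons size_tuple it ltnn eqxx.
Qed.

Lemma measurable_rcons1 t (x : t.-tuple (measurableTypeR R)) :
  measurable_fun [set: measurableTypeR R] (fun r => [tuple of rcons x r]).
Proof.
exact: (measurableT_comp (@measurable_rcons t) (@measurable_pair1 _ _ _ _ x)).
Qed.

Lemma measurable_belast t :
  measurable_fun [set: t.+1.-tuple (measurableTypeR R)]
    (fun x => [tuple tnth x (widen_ord (leqnSn t) i) | i < t]).
Proof.
apply/measurable_fun_tnthP => i.
rewrite (_ : _ \o _ =
  fun x : t.+1.-tuple (measurableTypeR R) => tnth x (widen_ord (leqnSn t) i)).
  exact: measurable_tnth.
by apply/funext => x /=; rewrite tnth_mktuple.
Qed.

Lemma measurable_arms t (a : seq 'I_k) : measurable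
  [set x : t.-tuple (measurableTypeR R) | arms (trajectory pi x) = a].
Proof.
elim: t a => [|t ih] a.
  rewrite (_ : [set x | _] = if a is [::] then setT else set0).
    by case: a.
  by apply/seteqP; split=> x /=; rewrite tuple0; case: a.
case/lastP: a => [|a i].
  rewrite (_ : [set x | _] = set0)//; apply/seteqP; split=> x //= /(congr1 size).
  by rewrite size_map size_trajectory size_tuple.
have [ta|ta] := eqVneq (size a) t; last first.
  rewrite (_ : [set x | _] = set0)//; apply/seteqP; split=> x //= /(congr1 size).
  rewrite size_map size_trajectory size_tuple size_rcons => -[tE].
  by rewrite tE eqxx in ta.
pose b : t.-tuple 'I_k := tcast ta (in_tuple a).
have bE : b = a :> seq _ by rewrite val_tcast.
pose p (x : t.+1.-tuple (measurableTypeR R)) :=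
  [tuple tnth x (widen_ord (leqnSn t) i) | i < t].
have pE (x : t.+1.-tuple (measurableTypeR R)) :
    x = rcons (p x) (tnth x ord_max) :> seq _.
  apply: (@eq_from_nth _ 0) => [|j]; first by rewrite size_rcons !size_tuple.
  rewrite size_tuple ltnS => jt; rewrite nth_rcons size_tuple.
  have [jlt|jge] := ltnP j t.
    by rewrite -(tnth_nth _ (p x) (Ordinal jlt)) tnth_mktuple (tnth_nth 0).
  have -> : j = t by apply/eqP; rewrite eqn_leq jt.
  by rewrite eqxx (tnth_nth 0).
have tE (x : t.+1.-tuple (measurableTypeR R)) : trajectory pi x =
    rcons (trajectory pi (p x)) (pull pi (p x), tnth x ord_max).
  by rewrite -trajectory_rcons; congr trajectory; exact: pE.
rewrite (_ : [set x | _] = p @^-1` (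
  [set x : t.-tuple (measurableTypeR R) | arms (trajectory pi x) = a] `&`
  [set x : t.-tuple (measurableTypeR R) | pi (zip b x) = i])).
  rewrite -[X in measurable X]setTI; apply: measurable_belast => //.
  by apply: measurableI; [exact: ih|exact: measurable_act].
apply/seteqP; split=> x /=; rewrite tE.
  rewrite /arms map_rcons => /rcons_inj[aE iE]; split=> //.
  by rewrite bE -aE -/(arms _) -trajectoryE.
rewrite bE => -[aE <-]; rewrite /arms map_rcons /=.
by rewrite -/(arms _) {1}aE /pull [in LHS]trajectoryE aE.
Qed.

Lemma measurable_fibers d (S : measurableType d) (F : finType)
    (f : S -> F) (g : F -> S -> \bar R) :
  (forall a, measurable [set x | f x = a]) ->
  (forall a, measurable_fun [set: S] (g a)) ->
  measurable_fun [set: S] (fun x => g (f x) x).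
Proof.
move=> mf mg _ B mB; rewrite setTI.
rewrite (_ : _ @^-1` B =
    \bigcup_(a in [set: F]) ([set x | f x = a] `&` (g a @^-1` B))).
  apply: fin_bigcup_measurable => // a _; apply: measurableI => //.
  by rewrite -[X in measurable X]setTI; exact: mg.
apply/seteqP; split=> x /=; first by move=> Bx; exists (f x).
by move=> [a _ [/= <-]].
Qed.

Definition step t (x : t.-tuple (measurableTypeR R)) :
    giry (t.+1.-tuple (measurableTypeR R)) R :=
  giry_map (measurable_rcons1 x) (reward_law x).

Lemma measurable_step t :
  measurable_fun [set: t.-tuple (measurableTypeR R)] (@step t).
Proof.
apply: measurable_giry_codensity => // B mB.
pose C := (fun z : t.-tuple (measurableTypeR R) * measurableTypeR R =>
  [tuple of rcons z.1 z.2]) @^-1` B.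
have mC : measurable C.
  by rewrite -[C]setTI; exact: measurable_rcons.
have sz (x : t.-tuple (measurableTypeR R)) :
    size (arms (trajectory pi x)) == t.
  by rewrite size_map size_trajectory size_tuple.
pose f x : t.-tuple 'I_k * 'I_k := (Tuple (sz x), pull pi x).
pose g (a : t.-tuple 'I_k * 'I_k) (x : t.-tuple (measurableTypeR R)) :=
  nu a.2 (triggers G (rcons a.1 a.2) a.2) (xsection C x).
rewrite (_ : (fun x => _) = fun x => g (f x) x); last first.
  by apply/funext => x; rewrite /g /= xsectionE.
apply: (@measurable_fibers _ _ _ f g) => [[a i]|a]; last first.
  exact: measurable_fun_xsection.
rewrite (_ : [set x | _] =
  [set x : t.-tuple (measurableTypeR R) | arms (trajectory pi x) = a] `&`
  [set x : t.-tuple (measurableTypeR R) | pi (zip a x) = i]).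
  by apply: measurableI; [exact: measurable_arms|exact: measurable_act].
apply/seteqP; split=> x; rewrite /f /pull /=.
  by move=> [<- <-] /=; rewrite -trajectoryE.
by move=> [aE iE]; congr pair; [exact: val_inj|rewrite trajectoryE aE].
Qed.

Fixpoint sub_law t : giry (t.-tuple (measurableTypeR R)) R :=
  if t is t'.+1 then giry_bind (sub_law t') (@measurable_step t')
  else giry_ret [tuple].

Lemma sub_lawT t : sub_law t setT = 1%E.
Proof.
have massE d (S : measurableType d) (m : giry S R) :
    m setT = giry_int m (cst 1%E).
  by rewrite /giry_int integral_cst// mul1e.
elim: t => [|t ih]; first by rewrite /= /giry_ret /= diracT.
rewrite massE /= giry_int_bind// -[RHS]ih [RHS]massE; apply: eq_integral => x _.
rewrite -massE -[LHS]/(reward_law x setT); exact: probability_setT.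
Qed.

(* Law of the rewards collected in rounds 1, ..., t: given past rewards x, the
   next one has distribution [reward_law x]. *)
Definition law t : set (t.-tuple (measurableTypeR R)) -> \bar R := sub_law t.

Arguments law : clear implicits.

HB.instance Definition _ t := isMeasure.Build _ _ _ (law t)
  (measure0 (sub_law t)) (measure_ge0 (sub_law t))
  (@measure_semi_sigma_additive _ _ _ (sub_law t)).

HB.instance Definition _ t :=
  Measure_isProbability.Build _ _ _ (law t) (sub_lawT t).

End law.
Arguments law : clear implicits.

Definition performance (T : nat) (pi : policy) : \bar R :=
  'E_(law pi T)[fun x : T.-tuple (measurableTypeR R) =>
    \sum_(t < T) mu (pull pi (take t x)) (ntriggers_pull pi (take t x))].

(* The default 0 is harmless: cliques are nonempty and means lie in [0, 1]. *)
Definition max_mean (c : {set 'I_k}) (n : nat) : R :=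
  \big[Num.max/0]_(i in c) mu i n.

(* At each of the rounds 1, ..., T, whatever the rewards observed before. *)
Definition greedy (T : nat) (pi : policy) :=
  forall (x : seq R) (j : 'I_k), (size x < T)%N ->
    mu j (ntriggers pi x j).+1 <=
    mu (pull pi x) (ntriggers pi x (pull pi x)).+1.

Definition optimal (T : nat) (pi : policy) :=
  forall pi' : policy, (performance T pi' <= performance T pi)%E.

End interaction.

Arguments law {R k} nu G pi t _.

(* Main.v *)
(** For a block-diagonal [G] the number of triggers of an arm is the number of
    pulls of its clique, so along any trajectory the reward collected is at most
    the sum over cliques [c] of the first [N c] terms of [max_mean nu c], where
    [N c] counts the pulls of [c]; for the greedy policy this is an equality.
    The greedy counts maximise that sum among all [N] with the same total: if
    [N'] has total [t+1] and [N] is the greedy count after [t] rounds, then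
    [N d < N' d] for some [d]; the [N' d]-th term of [d] is at most its
    [(N d).+1]-th term, hence at most the next greedy reward, and removing one
    pull of [d] from [N'] reduces to [t]. In particular the greedy reward is the
    same on all trajectories. *)

Require Import Defs.
From HB Require Import structures.
From mathcomp Require Import all_boot all_order all_algebra.
From mathcomp Require Import all_classical all_reals all_analysis.

Set Implicit Arguments.
Unset Strict Implicit.
Unset Printing Implicit Defensive.

Import Order.TTheory GRing.Theory Num.Theory.

Local Open Scope ring_scope.

(* An integral of a nonnegative function is a supremum over the simple functions
   below it, so [X] need not be measurable. *)
Lemma expectation_le_cst (R : realType) d (S : measurableType d)
    (P : probability S R) (X : S -> R) (r : R) :
  (forall x, 0 <= X x <= r) -> ('E_P[X] <= r%:E)%E.
Proof.
move=> X0r; rewrite -(expectation_cst P r) unlock.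
rewrite !ge0_integralTE => [|x|x]; rewrite ?lee_fin; first last.
- by have /andP[] := X0r x.
- by have /andP[+ +] := X0r x; exact: le_trans.
apply: ereal_sup_le => _ /= [h hX <-]; exists h => // x.
by apply: le_trans (hX x) _; rewrite lee_fin; have /andP[] := X0r x.
Qed.

Section cliques.
Context (k : nat) (G : 'M[bool]_k) (C : {set {set 'I_k}}).
Hypothesis hC : clique_partition G C.

(** Cliques are disjoint, so any clique witnessing the edge between [j] and [i] is the one that
    contains [i]. *)
Lemma mem_clique (c : {set 'I_k}) i j : c \in C -> i \in c -> G j i = (j \in c).
Proof.
have [/and3P[_ tC _] GE] := hC => cC ic; rewrite GE.
apply/existsP/idP => [[d /and3P[dC jd id]]|jc]; last by exists c; rewrite cC jc.
by rewrite -(def_pblock tC cC ic) (def_pblock tC dC id).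
Qed.

Lemma triggers_clique (c : {set 'I_k}) i s :
  c \in C -> i \in c -> triggers G s i = count (mem c) s.
Proof. by move=> cC ic; apply: eq_count => j; exact: mem_clique. Qed.

Lemma mem_pblock_clique i : i \in finset.pblock C i.
Proof. by have [/and3P[/eqP cC _ _] _] := hC; rewrite mem_pblock cC inE. Qed.

Lemma pblock_clique i : finset.pblock C i \in C.
Proof.
by have [/and3P[/eqP cC _ _] _] := hC; rewrite pblock_mem // cC inE.
Qed.

Lemma mem_clique_pblock (c : {set 'I_k}) i :
  c \in C -> (i \in c) = (c == finset.pblock C i).
Proof.
have [/and3P[_ tC _] _] := hC => cC; apply/idP/eqP => [ic|->].
  by rewrite (def_pblock tC cC ic).
exact: mem_pblock_clique.
Qed.

End cliques.

Section clique_value.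
Context (R : realType) (k : nat).
Variables (nu : 'I_k -> nat -> probability (measurableTypeR R) R)
          (G : 'M[bool]_k) (C : {set {set 'I_k}}).

(** The counts [N] need not come from a policy, so that the exchange argument may remove a single
    pull. *)
Definition clique_value (N : {set 'I_k} -> nat) : R :=
  \sum_(c in C) \sum_(1 <= n < (N c).+1) max_mean nu c n.

Lemma eq_clique_value N N' :
  {in C, N =1 N'} -> clique_value N = clique_value N'.
Proof. by move=> NN'; apply: eq_bigr => c cC; rewrite NN'. Qed.

Lemma clique_valueS N d : d \in C ->
  clique_value (fun c => (N c + (c == d))%N) =
  clique_value N + max_mean nu d (N d).+1.
Proof.
move=> dC; rewrite /clique_value (bigD1 d)//= [in RHS](bigD1 d)//= eqxx addn1.
rewrite big_nat_recr//= addrAC; congr (_ + _ + _).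
by apply: eq_bigr => c /andP[_ /negbTE ->]; rewrite addn0.
Qed.

Lemma max_mean_ge (c : {set 'I_k}) i n : i \in c -> mu nu i n <= max_mean nu c n.
Proof. exact: le_bigmax_cond. Qed.

Hypothesis hrot : rotting_gtb nu G.

Lemma max_mean_ge0 c n : 0 <= max_mean nu c n.
Proof. exact: bigmax_ge_id. Qed.

Lemma muS_ge0 i n : 0 <= mu nu i n.+1.
Proof. by have [[_ mu01] _] := hrot; have [//|_ /andP[]] := mu01 i n.+1. Qed.

Lemma mu_nonincreasing i m n : (m <= n)%N -> mu nu i n.+1 <= mu nu i m.+1.
Proof.
have [_ rot] := hrot; move=> /subnKC <-.
elim: (n - m)%N => [|d ih]; first by rewrite addn0.
by apply: le_trans ih; rewrite addnS -subr_le0 rot.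
Qed.

Lemma max_mean_nonincreasing c m n :
  (m <= n)%N -> max_mean nu c n.+1 <= max_mean nu c m.+1.
Proof.
move=> mn; apply: bigmax_le => [|i ic]; first exact: max_mean_ge0.
exact: le_trans (mu_nonincreasing i mn) (max_mean_ge _ ic).
Qed.

Hypothesis hC : clique_partition G C.

Lemma npulls_rcons (pi : policy R k) x r c : c \in C ->
  npulls pi (rcons x r) c =
  (npulls pi x c + (c == finset.pblock C (pull pi x)))%N.
Proof.
move=> cC; rewrite /npulls trajectory_rcons /arms map_rcons -cats1 count_cat /=.
by rewrite addn0 (mem_clique_pblock hC).
Qed.

Lemma ntriggersE (pi : policy R k) x c i : c \in C -> i \in c ->
  ntriggers G pi x i = npulls pi x c.
Proof. exact: triggers_clique. Qed.

Lemma ntriggers_pullE (pi : policy R k) x :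
  ntriggers_pull G pi x = (npulls pi x (finset.pblock C (pull pi x))).+1.
Proof.
have pC := mem_pblock_clique hC (pull pi x).
rewrite /ntriggers_pull (triggers_clique hC _ (pblock_clique hC _) pC).
by rewrite -cats1 count_cat /= addn0 pC addn1.
Qed.

Lemma sum_npulls (pi : policy R k) x : (\sum_(c in C) npulls pi x c)%N = size x.
Proof.
elim/last_ind: x => [|x r ih]; first by apply: big1.
under eq_bigr => c cC do rewrite npulls_rcons//.
rewrite big_split /= ih size_rcons -addn1; congr (_ + _)%N.
rewrite (bigD1 (finset.pblock C (pull pi x))) ?(pblock_clique hC)//= eqxx.
by rewrite big1 // => c /andP[_ /negbTE ->].
Qed.

Lemma clique_value_rcons (pi : policy R k) x r :
  clique_value (npulls pi (rcons x r)) = clique_value (npulls pi x) +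
  max_mean nu (finset.pblock C (pull pi x)) (ntriggers_pull G pi x).
Proof.
rewrite ntriggers_pullE -clique_valueS ?(pblock_clique hC)//.
by apply: eq_clique_value => c; exact: npulls_rcons.
Qed.

(** The integrand of [performance] with [size x] for the horizon, which allows induction on [x] by
    [rcons]. *)
Definition path_reward (pi : policy R k) (x : seq R) : R :=
  \sum_(t < size x)
    mu nu (pull pi (take t x)) (ntriggers_pull G pi (take t x)).

Lemma path_reward_rcons pi x r : path_reward pi (rcons x r) =
  path_reward pi x + mu nu (pull pi x) (ntriggers_pull G pi x).
Proof.
rewrite /path_reward size_rcons big_ord_recr /= -cats1 take_size_cat//.
by congr (_ + _); apply: eq_bigr => t _; rewrite takel_cat// ltnW.
Qed.

Lemma path_reward_ge0 pi x : 0 <= path_reward pi x.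
Proof.
apply: sumr_ge0 => t _; rewrite ntriggers_pullE; exact: muS_ge0.
Qed.

Lemma path_reward_le pi x : path_reward pi x <= clique_value (npulls pi x).
Proof.
elim/last_ind: x => [|x r ih].
  by rewrite /path_reward big_ord0 sumr_ge0 // => c _; rewrite big_geq.
rewrite path_reward_rcons clique_value_rcons lerD// max_mean_ge//.
exact: mem_pblock_clique hC _.
Qed.

Section greedy_policy.
Variables (T : nat) (pi : policy R k).
Hypothesis hgreedy : greedy nu G T pi.

(** All arms of [c] have the same trigger count [npulls pi x c], so the left side is a maximum over
    values that the greedy rule compares with its own choice. *)
Lemma greedy_max_mean x c : (size x < T)%N -> c \in C ->
  max_mean nu c (npulls pi x c).+1 <=
  mu nu (pull pi x) (ntriggers_pull G pi x).
Proof.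
move=> xT cC; rewrite ntriggers_pullE.
(* The maximum has default 0, so the bound must be nonnegative too. *)
apply: bigmax_le => [|i ic]; first exact: muS_ge0.
have := hgreedy i xT; rewrite (ntriggersE _ _ cC ic).
by rewrite (ntriggersE _ _ (pblock_clique hC _) (mem_pblock_clique hC _)).
Qed.

Lemma greedy_path_reward x :
  (size x <= T)%N -> path_reward pi x = clique_value (npulls pi x).
Proof.
elim/last_ind: x => [_|x r ih].
  by rewrite /path_reward big_ord0 /clique_value big1// => c _; rewrite big_geq.
rewrite size_rcons => xT.
rewrite path_reward_rcons clique_value_rcons ih ?(ltnW xT)//; congr (_ + _).
(* The greedy arm is in particular the best of its own clique. *)
apply/le_anti; rewrite max_mean_ge ?(mem_pblock_clique hC)//=.
by rewrite {1}ntriggers_pullE greedy_max_mean// (pblock_clique hC).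
Qed.

Lemma greedy_clique_value x N : (size x <= T)%N ->
  (\sum_(c in C) N c)%N = size x ->
  clique_value N <= clique_value (npulls pi x).
Proof.
elim/last_ind: x N => [|x r ih] N.
  move=> _ /eqP; rewrite sum_nat_eq0 => /forall_inP N0.
  by rewrite (@eq_clique_value _ (npulls pi [::]))// => c /N0/eqP.
rewrite size_rcons => xT sN.
(* Pigeonhole: the total of [N] exceeds that of the greedy counts after [x] by one. *)
have [d dC Nd] : exists2 d, d \in C & (npulls pi x d < N d)%N.
  apply/exists_inP; apply: contraT => /exists_inPn Nle.
  have : (\sum_(c in C) N c <= \sum_(c in C) npulls pi x c)%N.
    by apply: leq_sum => c /Nle; rewrite -leqNgt.
  by rewrite sN sum_npulls ltnn.
(* One pull of [d] is removed; the subtraction does not truncate, as [Nd] gives [0 < N d]. *)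
pose N' c := (N c - (c == d))%N.
have N'E : {in C, N =1 fun c => N' c + (c == d)}%N.
  move=> c _; rewrite /N' subnK//; case: eqP => //= ->.
  exact: leq_ltn_trans Nd.
have sN' : (\sum_(c in C) N' c)%N = size x.
  apply/eqP; rewrite -eqSS -sN (eq_bigr _ N'E) big_split /= -addn1.
  rewrite eqn_add2l (bigD1 d)//= eqxx big1 // => c /andP[_ /negbTE ->//].
rewrite (eq_clique_value N'E) clique_valueS// clique_value_rcons.
rewrite lerD ?ih ?(ltnW xT)//.
apply: (@le_trans _ _ (max_mean nu d (npulls pi x d).+1)).
  apply: max_mean_nonincreasing; rewrite /N' eqxx -ltnS subn1 prednK//.
  exact: leq_ltn_trans Nd.
apply: le_trans (greedy_max_mean xT dC) _.
exact: max_mean_ge (mem_pblock_clique hC _).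
Qed.

End greedy_policy.
End clique_value.

Theorem theorem9 (R : realType) (k ktilde T : nat)
    (nu : 'I_k -> nat -> probability (measurableTypeR R) R)
    (G : 'M[bool]_k) (C : {set {set 'I_k}}) (pistar : policy R k)
    (hrot : rotting_gtb nu G)
    (hblock : block_diagonal ktilde G)
    (hC : clique_partition G C)
    (hgreedy : greedy nu G T pistar) :
  optimal nu G T pistar /\
  forall x : T.-tuple R,
    performance nu G T pistar =
      (\sum_(c in C) \sum_(1 <= n < (npulls pistar x c).+1)
         max_mean nu c n)%:E
    /\ (forall (c : {set 'I_k}) (i : 'I_k), c \in C -> i \in c ->
          npulls pistar x c = ntriggers G pistar x i).
Proof.
have rewardE pi (x : T.-tuple R) : \sum_(t < T) mu nu (pull pi (take t x))
    (ntriggers_pull G pi (take t x)) = path_reward nu G pi x.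
  by rewrite /path_reward size_tuple.
have value_max pi (x y : T.-tuple R) :
    clique_value nu C (npulls pi x) <= clique_value nu C (npulls pistar y).
  apply: (greedy_clique_value hrot hC hgreedy); first by rewrite size_tuple.
  by rewrite (sum_npulls hC) !size_tuple.
have perfE (x : T.-tuple R) :
    performance nu G T pistar = (clique_value nu C (npulls pistar x))%:E.
  rewrite /performance -[RHS](expectation_cst (law nu G pistar T)).
  congr expectation; apply/funext => y /=.
  rewrite rewardE (greedy_path_reward hrot hC hgreedy) ?size_tuple//.
  (* With [pistar] on both sides, [value_max] makes the greedy value independent of the observed
     rewards. *)
  by apply/le_anti; rewrite !value_max.
split=> [pi|x]; last first.
  split; first exact: perfE.
  by move=> c i cC ic; rewrite (ntriggersE hC _ _ cC ic).
(* Any reward tuple would serve as reference, the greedy value being the same on all of them. *)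
rewrite (perfE [tuple of nseq T 0]); apply: expectation_le_cst => x.
rewrite rewardE (path_reward_ge0 hrot hC) /=.
exact: le_trans (path_reward_le nu hC pi x) (value_max _ _ _).
Qed.
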